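(* Let $M,N\in\mathcal{LC}$ with $M_j\le N_j$ for all $j\in\mathbb{N}$, and let $\omega_M,\omega_N$ be the corresponding associated weight functions. Then $$\beta(M,\Omega_N)=\frac{1}{\alpha(\omega_M,\omega_N)}.$$
   Context: $\mathbb{N}=\{0,1,2,\dots\}$. $\mathcal{LC}$ is the set of sequences $M=(M_j)_{j\in\mathbb{N}}$ of positive reals with $1=M_0\le M_1$, $M_j^2\le M_{j-1}M_{j+1}$ for $j\ge1$, and $\lim_j(M_j)^{1/j}=+\infty$. For $M\in\mathcal{LC}$: $\omega_M(t)=\sup_{j\in\mathbb{N}}\log(t^j/M_j)$ for $t>0$, $\omega_M(0)=0$; $\varphi_{\omega_M}(y)=\omega_M(e^y)$; $\varphi^*_{\omega_M}(x)=\sup_{y\ge0}\{xy-\varphi_{\omega_M}(y)\}$ for $x\ge0$. $\Omega_N=\{W^q:q>0\}$ with $W^q_j=\exp(\frac1q\varphi^*_{\omega_N}(qj))$ is the weight matrix associated with $\omega_N$. For $M,N\in\mathcal{LC}$ with $M\le N$, $\beta(M,\Omega_N)\in[0,\infty]$ is the supremum of all $b>0$ such that $$\exists q>1:\ \liminf_{j\to+\infty}\frac{\exp(\frac1{jq}\varphi^*_{\omega_N}(jq))}{\exp(\frac1j\varphi^*_{\omega_M}(j))}>q^b$$ ($j$ running over positive integers; equivalently $\liminf_j (W^q_j/M_j)^{1/j}>q^b$), with value $0$ if no such $b$ exists. For weight functions $\sigma\ge\omega$ (continuous, nondecreasing on $[0,\infty)$, vanishing at $0$, tending to $+\infty$),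 $\alpha(\sigma,\omega)\in[0,\infty]$ is the infimum of all $a>0$ such that $$\exists K>1:\ \limsup_{t\to+\infty}\frac{\omega(Kt)}{\sigma(t)}<K^a,$$ with value $\infty$ if no such $a$ exists. Conventions: $1/0=\infty$, $1/\infty=0$. *)

(* Defs.v *)
From mathcomp Require Import all_boot all_order all_algebra.
From mathcomp Require Import all_classical all_reals all_analysis.
Set Implicit Arguments.
Unset Strict Implicit.
Unset Printing Implicit Defensive.
Import Order.TTheory GRing.Theory Num.Theory.
Import numFieldNormedType.Exports.
Local Open Scope classical_set_scope.
Local Open Scope ring_scope.

Record classLC (R : realType) (M : nat -> R) : Prop := ClassLC {
  LC_gt0 : forall j, 0 < M j ;
  LC_0 : M 0%N = 1 ;
  LC_1 : 1 <= M 1%N ;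
  LC_logconvex : forall j, (1 <= j)%N -> M j ^+ 2 <= M j.-1 * M j.+1 ;
  LC_root : M j `^ (j%:R^-1) @[j --> \oo] --> +oo }.

(* [sup] is real-valued. For [classLC M] the sets in [assoc_weight] (at t > 0)
   and in [young_conj] (for phi = [phi_omega M]) are nonempty and bounded
   above, so both suprema are the genuine ones. *)
Definition assoc_weight (R : realType) (M : nat -> R) (t : R) : R :=
  if 0 < t then sup [set ln (t ^+ j / M j) | j in [set: nat]] else 0.

Definition phi_omega (R : realType) (M : nat -> R) (y : R) : R :=
  assoc_weight M (expR y).

Definition young_conj (R : realType) (phi : R -> R) (x : R) : R :=
  sup [set x * y - phi y | y in [set y : R | 0 <= y]].

(* beta(M, Omega_N); the weight matrix Omega_N = {W^q : q > 0},
   W^q_j = exp (phi^*_{omega_N} (q j) / q), enters through the numerator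
   (W^q_j)^(1/j). The index j ranges over positive integers, whence j.+1;
   [maxe 0] gives the value 0 when no b is admissible. *)
Definition beta (R : realType) (M N : nat -> R) : \bar R :=
  maxe 0%E (ereal_sup [set b%:E | b in [set b : R | 0 < b /\
    exists q : R, 1 < q /\
      ((q `^ b)%:E <
       limn_einf (fun j : nat =>
         (expR ((j.+1%:R * q)^-1 * young_conj (phi_omega N) (j.+1%:R * q))
          / expR (j.+1%:R^-1 * young_conj (phi_omega M) j.+1%:R))%:E))%E]]).

(* The quotient only matters for large t, where sigma t > 0. *)
Definition alpha (R : realType) (sigma omega : R -> R) : \bar R :=
  ereal_inf [set a%:E | a in [set a : R | 0 < a /\
    exists K : R, 1 < K /\
      (limf_esup (fun t : R => (omega (K * t) / sigma t)%:E) (pinfty_nbhs R)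
       < (K `^ a)%:E)%E]].

(* Main.v *)
Require Import Defs.
From mathcomp Require Import all_boot all_order all_algebra.
From mathcomp Require Import all_classical all_reals all_analysis.
From mathcomp Require Import lra.
Import Order.TTheory GRing.Theory Num.Theory.
Import numFieldNormedType.Exports.
Local Open Scope classical_set_scope.
Local Open Scope ring_scope.

(* Write phi_M, phi_N for [phi_omega M], [phi_omega N], and * for Young
   conjugation. Taking conjugates, phi_N(y + k) <= d phi_M(y) for large y gives
   phi_N^*(j d) >= j d k + d phi_M^*(j) for large j. Conversely,
   phi_N^*(j q) >= j q c + q phi_M^*(j) for large j gives
   phi_N(y + c) <= (q + e) phi_M(y) for large y and any e > 0, because an index
   can be rounded to a multiple of q at a cost linear in y while phi_M is
   superlinear. With k = c = ln K and d = q, the condition q < K^a coincides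
   with q^(1/a) < K, so b is admissible for beta if and only if 1/b is
   admissible for alpha. *)

(** * Extended-real limits, suprema and inverses *)

Lemma limf_esup_EFin_lt (R : realType) (T : choiceType) (X : filteredType T)
    (F : set_system X) (FF : Filter F) (f : X -> R) (x : R) :
  (limf_esup (fun t => (f t)%:E) F < x%:E)%E <->
  exists2 r, r < x & \forall t \near F, f t <= r.
Proof.
rewrite limf_esupE; split.
  case/ereal_inf_lt => _ [V FV <-] supVx.
  pose s := ereal_sup [set (f t)%:E | t in V].
  have le_s t : V t -> ((f t)%:E <= s)%E.
    by move=> Vt; apply: ereal_sup_ubound; exists t.
  move: supVx le_s; rewrite -/s; case: s => [r | |] // rx le_s.
    exists r; first by rewrite -lte_fin.
    by apply: filterS FV => t /le_s; rewrite lee_fin.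
  (* Here [s] is [-oo], so [V] is empty and any real below [x] will do. *)
  exists (x - 1); first by rewrite ltrBlDr ltrDl.
  by apply: filterS FV => t /le_s.
case=> r rx Fr; apply: (@le_lt_trans _ _ r%:E); last by rewrite lte_fin.
apply: ge_ereal_inf.
exists (ereal_sup [set (f t)%:E | t in [set t | f t <= r]]).
  by exists [set t | f t <= r].
by apply: ge_ereal_sup => _ [t /= ftr <-]; rewrite lee_fin.
Qed.

Lemma limn_einf_EFin_gt (R : realType) (u : nat -> R) (x : R) :
  (x%:E < limn_einf (fun n => (u n)%:E))%E <->
  exists2 r, x < r & \forall n \near \oo, r <= u n.
Proof.
rewrite /limn_einf lteNr /limn_esup -EFinN.
rewrite (limf_esup_EFin_lt R _ _ _ _ (fun n => - u n)).
split=> -[r xr ur]; exists (- r); rewrite ?ltrN2 //; first by rewrite ltrNr.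
  by apply: filterS ur => n; rewrite lerNl.
by apply: filterS ur => n; rewrite lerN2.
Qed.

(** Inversion is a decreasing involution of [0, +oo], so it exchanges suprema and infima. The
    [maxe 0] covers empty [S]: then [T] is empty too, its infimum is [+oo], and the inverse of that
    is 0. *)
Lemma maxe0_ereal_sup_inv (R : realType) (S T : set R) :
    (forall x, S x -> 0 < x) -> (forall x, T x -> 0 < x) ->
    (forall x, 0 < x -> S x <-> T x^-1) ->
  (maxe 0 (ereal_sup [set x%:E | x in S])
   = 1 / ereal_inf [set x%:E | x in T])%E.
Proof.
move=> S_gt0 T_gt0 ST; rewrite mul1e.
set B := maxe _ _; set A := ereal_inf _.
have B_ge0 : (0 <= B)%E by rewrite /B le_max lexx.
have A_ge0 : (0 <= A)%E.
  by apply: le_ereal_inf_tmp => _ [x /T_gt0 x0 <-]; rewrite lee_fin ltW.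
have invE (x : R) : 0 < x -> ((x^-1)%:E = (x%:E)^-1)%E.
  by move=> x0; rewrite inver gt_eqF.
apply/le_anti/andP; split.
  rewrite /B ge_max inve_ge0 A_ge0 /=.
  apply: ge_ereal_sup => _ [x Sx <-]; have x0 := S_gt0 _ Sx.
  rewrite -[x]invrK invE ?invr_gt0 // lee_pV2 ?inE //=; last first.
    by rewrite lee_fin invr_ge0 ltW.
  by apply: ereal_inf_lbound; exists x^-1 => //; apply/ST.
rewrite -[B]inveK lee_pV2 ?inE ?inve_ge0 //.
apply: le_ereal_inf_tmp => _ [x Tx <-]; have x0 := T_gt0 _ Tx.
rewrite -[x]invrK invE ?invr_gt0 // lee_pV2 ?inE //=; last first.
  by rewrite lee_fin invr_ge0 ltW.
rewrite /B le_max; apply/orP; right; apply: ereal_sup_ubound.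
by exists x^-1 => //; apply/ST; rewrite ?invr_gt0 ?invrK.
Qed.

Lemma ltr_powRV (R : realType) (a x y : R) : 0 < a -> 0 <= x -> 0 <= y ->
  (x `^ a^-1 < y) = (x < y `^ a).
Proof.
move=> a0 x0 y0.
have K (z b : R) : 0 <= z -> b != 0 -> (z `^ b) `^ b^-1 = z.
  by move=> z0 b0; rewrite -powRrM mulfV // powRr1.
apply/idP/idP => [/(gt0_ltr_powR a0)|].
  have := K x a^-1; rewrite invrK invr_eq0 gt_eqF // => -> //.
  by apply; rewrite nnegrE ?powR_ge0.
have aV0 : 0 < a^-1 by rewrite invr_gt0.
move/(gt0_ltr_powR aV0); rewrite K ?gt_eqF //.
by apply; rewrite nnegrE ?powR_ge0.
Qed.

(** * Affine minorants and conjugate of one associated weight *)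

Section associated_weight.
Variables (R : realType) (M : nat -> R) (hM : classLC M).

Let ln_term y j : ln (expR y ^+ j / M j) = j%:R * y - ln (M j).
Proof.
rewrite ln_div ?posrE ?exprn_gt0 ?expR_gt0 ?(LC_gt0 hM) //.
by rewrite -expRM_natl expRK.
Qed.

(** By [LC_root], M_j^(1/j) >= e^y for large j, which makes the j-th term nonpositive; only finitely
    many terms remain. *)
Lemma phi_omega_has_ubound y :
  has_ubound [set ln (expR y ^+ j / M j) | j in [set: nat]].
Proof.
have [n _ hn] := cvgry_ge (LC_root hM) (expR y).
(* Summing up to [n] inclusive leaves only positive indices in the tail, so that [j%:R^-1] is a
   genuine inverse there. *)
exists (\sum_(i < n.+1) `|i%:R * y - ln (M i)|) => _ [j _ <-]; rewrite ln_term.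
have [jn|nj] := ltnP j n.+1.
  rewrite (bigD1 (Ordinal jn)) //=; apply: (le_trans (ler_norm _)).
  by rewrite lerDl sumr_ge0.
apply: (@le_trans _ _ 0); last exact: sumr_ge0.
have /= := hn j (ltnW nj).
rewrite -ler_ln ?posrE ?expR_gt0 ?powR_gt0 ?(LC_gt0 hM) //.
rewrite expRK ln_powR ler_pdivlMl ?ltr0n ?(leq_trans _ nj) //.
by rewrite subr_le0.
Qed.

Lemma phi_omega_ge j y : j%:R * y - ln (M j) <= phi_omega M y.
Proof.
rewrite /phi_omega /assoc_weight expR_gt0 -ln_term.
by apply: (ub_le_sup (phi_omega_has_ubound y)); exists j.
Qed.

Lemma phi_omega_le u y :
  (forall j, j%:R * y - ln (M j) <= u) -> phi_omega M y <= u.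
Proof.
move=> hu; rewrite /phi_omega /assoc_weight expR_gt0; apply: ge_sup.
  by exists (ln (expR y ^+ 0 / M 0)); exists 0%N.
by move=> _ [j _ <-]; rewrite ln_term.
Qed.

Lemma phi_omega_ge0 y : 0 <= phi_omega M y.
Proof. by have := phi_omega_ge 0 y; rewrite (LC_0 hM) ln1 mul0r subr0. Qed.

(** A single minorant j y - ln M_j suffices: choose e j >= A + 1, and the surplus y absorbs the
    constants. *)
Lemma phi_omega_superlinear (A B e : R) : 0 < e ->
  \forall y \near +oo, A * y + B <= e * phi_omega M y.
Proof.
move=> e0; pose j := (Num.trunc `|(A + 1) / e|).+1.
have Aj : A + 1 <= e * j%:R.
  rewrite mulrC -ler_pdivrMr //; apply: (le_trans (ler_norm _)).
  by apply/ltW; rewrite -truncn_lt_nat.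
near=> y.
have y0 : 0 <= y by near: y; apply: nbhs_pinfty_ge; exact: num_real.
have yB : B + e * ln (M j) <= y.
  by near: y; apply: nbhs_pinfty_ge; exact: num_real.
apply: (@le_trans _ _ (e * (j%:R * y - ln (M j)))).
  rewrite mulrBr lerBrDr mulrA.
  have := ler_wpM2r y0 Aj; rewrite mulrDl mul1r; lra.
by rewrite ler_pM2l //; exact: phi_omega_ge.
Unshelve. all: by end_near. Qed.

(** The real-valued [sup] dominates its members only if the set is bounded: ln M_j is a bound for
    any integer j >= x. *)
Lemma young_conj_ge x y :
  0 <= y -> x * y - phi_omega M y <= young_conj (phi_omega M) x.
Proof.
move=> y0; apply: ub_le_sup; last by exists y.
pose j := (Num.trunc `|x|).+1.
exists (ln (M j)) => _ [z /= z0 <-].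
have xj : x <= j%:R.
  by apply: (le_trans (ler_norm _)); apply/ltW; rewrite -truncn_lt_nat.
have := phi_omega_ge j z; have := ler_wpM2r z0 xj; lra.
Qed.

Lemma young_conj_le u x : (forall y, 0 <= y -> x * y - phi_omega M y <= u) ->
  young_conj (phi_omega M) x <= u.
Proof.
move=> hu; apply: ge_sup; first by exists (x * 0 - phi_omega M 0), 0 => //=.
by move=> _ [y /= y0 <-]; exact: hu.
Qed.

Lemma assoc_weightE t : 0 < t -> assoc_weight M t = phi_omega M (ln t).
Proof. by move=> t0; rewrite /phi_omega lnK. Qed.

Lemma young_conj_le_ln x i :
  x <= i%:R -> young_conj (phi_omega M) x <= ln (M i).
Proof.
move=> xi; apply: young_conj_le => z z0.
have := phi_omega_ge i z; have := ler_wpM2r z0 xi; lra.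
Qed.

End associated_weight.

(** * Transfer of dilation estimates through conjugation *)

Section conjugation.
Variables (R : realType) (M N : nat -> R) (hM : classLC M) (hN : classLC N).

Lemma young_conj_dilation (d k : R) : 0 < d -> 0 <= k ->
    (\forall y \near +oo, phi_omega N (y + k) <= d * phi_omega M y) ->
  \forall j \near \oo, j%:R * d * k + d * young_conj (phi_omega M) j%:R
    <= young_conj (phi_omega N) (j%:R * d).
Proof.
move=> d0 k0 hMN.
have [y0 y0_gt0 [y0_real hy0]] : exists2 y0 : R, 0 < y0 & y0 \is Num.real /\
    forall y, y0 < y -> phi_omega N (y + k) <= d * phi_omega M y.
  case: hMN => z [zr hz]; exists (`|z| + 1); first by rewrite ltr_wpDl.
  split=> [|y zy]; first exact: num_real.
  by apply: hz; apply: le_lt_trans zy; rewrite (le_trans (ler_norm _)) // lerDl.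
near=> j.
(* This makes j (y0 + 1) - phi_M(y0 + 1) >= j y0, so the point y0 + 1 beats every y <= y0, where the
   hypothesis gives nothing. *)
have jy0 : phi_omega M (y0 + 1) <= j%:R by near: j; exact: nbhs_infty_ger.
suff young_le : young_conj (phi_omega M) j%:R <=
    d^-1 * (young_conj (phi_omega N) (j%:R * d) - j%:R * d * k).
  by rewrite addrC -lerBrDr -ler_pdivlMl.
have large y : y0 < y -> j%:R * y - phi_omega M y <=
    d^-1 * (young_conj (phi_omega N) (j%:R * d) - j%:R * d * k).
  move=> yy; rewrite ler_pdivlMl //.
  have yk : 0 <= y + k by rewrite addr_ge0 // ltW // (lt_trans y0_gt0).
  (* The shifted point y + k is the competitor in phi_N^*(j d). *)
  have := young_conj_ge _ _ hN (j%:R * d) _ yk; have := hy0 _ yy; lra.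
apply: (young_conj_le) => y y_ge0.
have [|yy] := ltP y0 y; first exact: large.
apply: le_trans (large (y0 + 1) _); last by rewrite ltrDl.
have := phi_omega_ge0 _ _ hM y.
have : j%:R * y <= j%:R * y0 by rewrite ler_wpM2l.
lra.
Unshelve. all: by end_near. Qed.

Lemma phi_omega_dilation (q c e : R) : 0 < q -> 0 <= c -> 0 < e ->
    (\forall j \near \oo, j%:R * q * c + q * young_conj (phi_omega M) j%:R
       <= young_conj (phi_omega N) (j%:R * q)) ->
  \forall y \near +oo, phi_omega N (y + c) <= (q + e) * phi_omega M y.
Proof.
move=> q0 c0 e0 [j0 _ hj0]; near=> y.
have y0 : 0 <= y by near: y; apply: nbhs_pinfty_ge; exact: num_real.
(* One threshold serves both cases below: the rounding cost q (y + c) when j >= j0, and the whole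
   term i (y + c) - ln N_i when j < j0, where -ln N_i <= phi_N(0). *)
have ye : j0.+1%:R * q * y + (j0.+1%:R * q * c + phi_omega N 0)
    <= e * phi_omega M y by near: y; exact: phi_omega_superlinear.
apply: (phi_omega_le _ _ hN) => i.
have yc : 0 <= y + c by rewrite addr_ge0.
(* Rounding i down to j * q costs at most q * (y + c), which is negligible
   with respect to phi_omega M y. *)
pose j := Num.trunc (i%:R / q).
have /andP[] : j%:R <= i%:R / q < j.+1%:R.
  by rewrite truncn_itv // divr_ge0 // ltW.
rewrite ler_pdivlMr // ltr_pdivrMr // => ji ij.
have ijy : i%:R * (y + c) <= j.+1%:R * q * (y + c) by rewrite ler_wpM2r // ltW.
have phiM0 := phi_omega_ge0 _ _ hM y; have phiN0 := phi_omega_ge0 _ _ hN 0.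
have [jj0|jj0] := ltnP j j0.
  have : j.+1%:R * q * (y + c) <= j0.+1%:R * q * (y + c).
    by rewrite ler_wpM2r // ler_pM2r // ler_nat ltnS ltnW.
  have : 0 <= q * phi_omega M y by rewrite mulr_ge0 // ltW.
  have := phi_omega_ge _ _ hN i 0; lra.
have := hj0 _ jj0 => /= young_ge.
have := young_conj_le_ln _ _ hN _ _ ji.
have : q * (j%:R * y - phi_omega M y) <= q * young_conj (phi_omega M) j%:R.
  by rewrite ler_pM2l // young_conj_ge.
have : 1 * (q * (y + c)) <= j0.+1%:R * (q * (y + c)).
  by rewrite ler_wpM2r ?ler1n // mulr_ge0 // ltW.
move: ijy; rewrite [j.+1%:R]mulrS; lra.
Unshelve. all: by end_near. Qed.

(* [(W^q_j / M_j)^(1/j)] in the notation of the paper. *)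
Definition weight_quotient q j : R :=
  expR ((j%:R * q)^-1 * young_conj (phi_omega N) (j%:R * q))
  / expR (j%:R^-1 * young_conj (phi_omega M) j%:R).

Lemma weight_quotient_ge (q c : R) j : 0 < q -> (0 < j)%N ->
  (expR c <= weight_quotient q j) =
  (j%:R * q * c + q * young_conj (phi_omega M) j%:R
   <= young_conj (phi_omega N) (j%:R * q)).
Proof.
move=> q0 j0; have j0' : 0 < j%:R :> R by rewrite ltr0n.
rewrite /weight_quotient -expRN -expRD ler_expR lerBrDr.
rewrite ler_pdivlMl ?mulr_gt0 //.
by rewrite mulrDr [j%:R * q * (_ * _)]mulrACA mulfV ?gt_eqF // mul1r.
Qed.

Lemma beta_admissible_of_alpha (a d K : R) : 0 < a -> 1 < d -> 1 < K ->
    d < K `^ a ->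
    (\forall t \near +oo, assoc_weight N (K * t) / assoc_weight M t <= d) ->
  ((d `^ a^-1)%:E < limn_einf (fun j => (weight_quotient d j.+1)%:E))%E.
Proof.
move=> a0 d1 K1 dK [t0 [t0r ht]].
have d0 : 0 < d by apply: lt_trans d1.
have K0 : 0 < K by apply: lt_trans K1.
(* The dilation factor [K] itself bounds the quotients from below eventually. *)
apply/limn_einf_EFin_gt; exists K.
  by rewrite ltr_powRV // ltW.
have [|n0 _ hn] := young_conj_dilation d (ln K) d0 (ln_ge0 (ltW K1)).
  near=> y.
  have y0 : 0 < expR y by exact: expR_gt0.
  have phi0 : 0 < phi_omega M y.
    have : 0 * y + 1 <= 1 * phi_omega M y.
      by near: y; apply: phi_omega_superlinear.
    by rewrite mul0r add0r mul1r; apply: lt_le_trans.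
  rewrite -ler_pdivrMr // /phi_omega expRD lnK // (mulrC _ K).
  (* Replacing [t0] by [|t0| + 1] makes the logarithm meaningful, as [t0] may be nonpositive. *)
  apply: ht; near: y; exists (ln (`|t0| + 1)); split; first exact: num_real.
  move=> y; rewrite -ltr_expR lnK ?posrE ?ltr_wpDl //.
  by apply: lt_trans; rewrite (le_lt_trans (ler_norm _)) // ltrDl.
exists n0 => // j /= nj; rewrite -[X in X <= _](@lnK R) //.
by rewrite weight_quotient_ge //; apply: hn; exact: leqW.
Unshelve. all: by end_near. Qed.

Lemma alpha_admissible_of_beta (b q r : R) : 0 < b -> 1 < q -> q `^ b < r ->
    (\forall j \near \oo, r <= weight_quotient q j.+1) ->
  (limf_esup (fun t => (assoc_weight N (r * t) / assoc_weight M t)%:E)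
     (pinfty_nbhs R) < (r `^ b^-1)%:E)%E.
Proof.
move=> b0 q1 qr [n0 _ hr].
have q0 : 0 < q by apply: lt_trans q1.
have qb1 : 1 < q `^ b by rewrite -ltr_powRV ?powR1 // ltW.
have r1 : 1 < r by apply: lt_trans qr.
have r0 : 0 < r by apply: lt_trans r1.
have qrb : q < r `^ b^-1.
  by rewrite -ltr_powRV ?invr_gt0 ?invrK // ltW.
(* Half the gap, so that q + e remains strictly below r^(1/b). *)
pose e := (r `^ b^-1 - q) / 2.
have e0 : 0 < e by rewrite divr_gt0 // subr_gt0.
apply/limf_esup_EFin_lt; exists (q + e); first by rewrite /e; lra.
have [|y0 [y0r hy]] := phi_omega_dilation q (ln r) e q0 (ln_ge0 (ltW r1)) e0.
  exists n0.+1 => // -[//|j] /= nj.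
  by rewrite -weight_quotient_ge // lnK //; apply: hr.
(* With slope 0 and constant 1 this gives phi_M >= 1 eventually, which permits division by it. *)
have [z0 [z0r hz]] := phi_omega_superlinear _ _ hM 0 1 1 ltr01.
near=> t.
have t0 : 0 < t by near: t; apply: nbhs_pinfty_gt; exact: num_real.
have ty : y0 < ln t by rewrite -ltr_expR lnK.
have tz : z0 < ln t by rewrite -ltr_expR lnK.
rewrite assoc_weightE ?mulr_gt0 // (assoc_weightE _ _ t) // ler_pdivrMr.
  by rewrite lnM ?posrE // addrC; exact: hy.
by have := hz _ tz; rewrite mul0r add0r mul1r; apply: lt_le_trans.
Unshelve. all: by end_near. Qed.

End conjugation.

Theorem proposition3p6 (R : realType) (M N : nat -> R)
    (hM : classLC M) (hN : classLC N) (hMN : forall j : nat, M j <= N j) :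
  (beta M N = 1 / alpha (assoc_weight M) (assoc_weight N))%E.
Proof.
apply: maxe0_ereal_sup_inv => [b []//|a []//|b b0]; split.
  move=> [_ [q [q1 /limn_einf_EFin_gt[r qr ur]]]].
  split; first by rewrite invr_gt0.
  exists r; split.
    apply: lt_trans qr.
    by rewrite -ltr_powRV ?powR1 // ltW // (lt_trans _ q1).
  by apply: (alpha_admissible_of_beta _ _ _ hM hN _ q).
move=> [_ [K [K1 /limf_esup_EFin_lt[r rK ut]]]]; split=> //.
(* The bound [r] on the ratio may be at most 1, whereas beta asks for q > 1. Both [r] and 1 lie
   below K^(1/b), so a midpoint [d] above their maximum still does. *)
pose m := Num.max r 1; have bV0 : 0 < b^-1 by rewrite invr_gt0.
have mK : m < K `^ b^-1.
  by rewrite gt_max rK -ltr_powRV ?invrK ?powR1 // ltW // (lt_trans _ K1).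
pose d := (m + K `^ b^-1) / 2.
have md : m < d by rewrite midf_lt.
have d1 : 1 < d by apply: le_lt_trans md; rewrite le_max lexx orbT.
exists d; split => //; rewrite -[b in d `^ b]invrK.
apply: (beta_admissible_of_alpha _ _ _ hM hN _ _ K) => //.
  by rewrite midf_lt.
apply: filterS ut => t; move/le_trans; apply.
by apply: ltW; apply: le_lt_trans md; rewrite le_max lexx.
Qed.
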